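(* Let $\mathcal{F}=\{f_1,\ldots,f_J\}$ be an iterated function system on $\mathbb{R}^d$. Let $C_0\subseteq\mathbb{R}^d$ be a compact set which is nice with respect to $\mathcal{F}$, and assume that (1) $C_0$ is a finite union of convex polytopes, and (2) each $f_j$ is an invertible affine transformation. Then there exist constants $W_0,L_0$ such that for all integers $k\ge 1$ there exists a CPwL indicator function $\varphi_k\in \mathrm{NNF}_{W_0,\,L_0k}^{d\to 1}$ for the set $C_k=H^kC_0$.
   Context: Iterated function system (IFS): a finite collection $\{f_1,\ldots,f_J\}$ of contractive mappings $f_j:\mathbb{R}^d\to\mathbb{R}^d$. Its Hutchinson operator is $H(A)=\bigcup_{j=1}^J f_jA$ for $A\subseteq\mathbb{R}^d$, where $f_jA$ denotes the image of $A$; $H^k$ is its $k$-fold iterate. Nice set: a bounded set $A\subseteq\mathbb{R}^d$ is nice with respect to $\{f_1,\ldots,f_J\}$ if $f_jA\subseteq A$ for all $j=1,\ldots,J$ and $f_iA\cap f_jA=\emptyset$ for all $i\ne j$. Neural network functions: fix an arbitrary (arbitrarily large) compact set $\mathcal{K}\subseteq\mathbb{R}^{d}$ on which all functions are considered. $\mathrm{ReLU}$ acts on a vector coordinatewise by $t\mapsto\max(t,0)$. A neural network function (NNF) is a function of the form $f(x)=\eta_1\circ\eta_2\circ\cdots\circ\eta_{2q+1}(x)$ for $x\in\mathcal{K}$, where $\eta_{2i-1}$ is an affine transformation for every $i=1,\ldots,q+1$ and $\eta_{2i}=\mathrm{ReLU}$ for every $i=1,\ldots,q$. The depth of such a representation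 is $q$, and its width is the maximal input or output dimension of all the $\eta_i$. $\mathrm{NNF}_{w,q}^{n_1\to n_2}$ is the family of functions $f:\mathcal{K}\subseteq\mathbb{R}^{n_1}\to\mathbb{R}^{n_2}$ having such a representation with depth at most $q$ and width at most $w$. CPwL indicator function: a continuous piecewise linear (CPwL) function $\varphi_C:\mathcal{K}\to\mathbb{R}$ is a CPwL indicator function of a compact set $C$ if $\varphi_C(x)\ge 0$ for $x\in C$ and $\varphi_C(x)<0$ for $x\notin C$ ($x\in\mathcal{K}$). *)

(* Defs.v *)
From HB Require Import structures.
From mathcomp Require Import all_boot all_order all_algebra.
From mathcomp Require Import all_classical all_reals all_analysis.

Set Implicit Arguments.
Unset Strict Implicit.
Unset Printing Implicit Defensive.

Import Order.TTheory GRing.Theory Num.Theory.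
Import numFieldNormedType.Exports.

Local Open Scope classical_set_scope.
Local Open Scope ring_scope.

(* R^n is 'cV[R]_n.  The library's norm on matrices is the sup norm; it is used
   below only through its topology and its bounded sets, which are the
   Euclidean ones.  Contractivity does depend on the norm, hence [enorm]. *)
Definition dotv (R : realType) (n : nat) (a x : 'cV[R]_n) : R :=
  \sum_(i < n) a i 0 * x i 0.

Definition enorm (R : realType) (n : nat) (x : 'cV[R]_n) : R :=
  Num.sqrt (dotv x x).

Definition contractive (R : realType) (d : nat)
    (f : 'cV[R]_d -> 'cV[R]_d) : Prop :=
  exists c : R, [/\ 0 <= c, c < 1 &
    forall x y : 'cV[R]_d, enorm (f x - f y) <= c * enorm (x - y)].

Definition is_IFS (R : realType) (d J : nat)
    (f : 'I_J -> 'cV[R]_d -> 'cV[R]_d) : Prop :=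
  forall j : 'I_J, contractive (f j).

Definition hutchinson (R : realType) (d J : nat)
    (f : 'I_J -> 'cV[R]_d -> 'cV[R]_d) (A : set 'cV[R]_d) : set 'cV[R]_d :=
  \bigcup_(j : 'I_J) (f j @` A).

Definition nice (R : realType) (d J : nat)
    (f : 'I_J -> 'cV[R]_d -> 'cV[R]_d) (A : set 'cV[R]_d) : Prop :=
  [/\ bounded_set A,
      forall j : 'I_J, f j @` A `<=` A &
      forall i j : 'I_J, i != j -> (f i @` A) `&` (f j @` A) = set0].

Definition invertible_affine (R : realType) (d : nat)
    (f : 'cV[R]_d -> 'cV[R]_d) : Prop :=
  exists (A : 'M[R]_d) (b : 'cV[R]_d),
    A \in unitmx /\ forall x : 'cV[R]_d, f x = A *m x + b.

Definition closed_halfspace (R : realType) (d : nat)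
    (H : set 'cV[R]_d) : Prop :=
  exists (a : 'cV[R]_d) (c : R), a != 0 /\ H = [set x | dotv a x <= c].

Definition polyhedron (R : realType) (d : nat) (P : set 'cV[R]_d) : Prop :=
  exists (m : nat) (H : 'I_m -> set 'cV[R]_d),
    (forall i : 'I_m, closed_halfspace (H i)) /\ P = \bigcap_(i : 'I_m) H i.

Definition convex_polytope (R : realType) (d : nat)
    (P : set 'cV[R]_d) : Prop :=
  polyhedron P /\ bounded_set P.

Definition finite_union_of_polytopes (R : realType) (d : nat)
    (C : set 'cV[R]_d) : Prop :=
  exists (m : nat) (P : 'I_m -> set 'cV[R]_d),
    (forall i : 'I_m, convex_polytope (P i)) /\ C = \bigcup_(i : 'I_m) P i.

Definition relu (R : realType) (n : nat) (x : 'cV[R]_n) : 'cV[R]_n :=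
  map_mx (fun t : R => Num.max t 0) x.

(* [network R q n1 n2] is the data of a composition of q + 1 affine maps with
   ReLU between consecutive ones; the innermost affine map comes first. *)
Inductive network (R : realType) : nat -> nat -> nat -> Type :=
| Affine (n1 n2 : nat) (A : 'M[R]_(n2, n1)) (b : 'cV[R]_n2) : network R 0 n1 n2
| Layer (q n1 m n2 : nat) (A : 'M[R]_(m, n1)) (b : 'cV[R]_m)
    (g : network R q m n2) : network R q.+1 n1 n2.

Fixpoint network_eval (R : realType) (q n1 n2 : nat) (g : network R q n1 n2) :
    'cV[R]_n1 -> 'cV[R]_n2 :=
  match g with
  | Affine _ _ A b => fun x => A *m x + b
  | Layer _ _ _ _ A b g' => fun x => network_eval g' (relu (A *m x + b))
  end.

Fixpoint network_width (R : realType) (q n1 n2 : nat)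
    (g : network R q n1 n2) : nat :=
  match g with
  | Affine n1' n2' _ _ => maxn n1' n2'
  | Layer _ n1' m _ _ _ g' => maxn (maxn n1' m) (network_width g')
  end.

(* A function on K is represented by a total function, of which only the
   values on K matter here and in [cpwl] and [cpwl_indicator]. *)
Definition NNF (R : realType) (n1 n2 : nat) (K : set 'cV[R]_n1) (w q : nat)
    (f : 'cV[R]_n1 -> 'cV[R]_n2) : Prop :=
  exists (q' : nat) (g : network R q' n1 n2),
    [/\ (q' <= q)%N, (network_width g <= w)%N &
        forall x : 'cV[R]_n1, K x -> f x = network_eval g x].

Definition cpwl (R : realType) (d : nat) (K : set 'cV[R]_d)
    (phi : 'cV[R]_d -> R) : Prop :=
  {within K, continuous phi} /\
  exists (m : nat) (P : 'I_m -> set 'cV[R]_d),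
    [/\ forall i : 'I_m, polyhedron (P i),
        K `<=` \bigcup_(i : 'I_m) P i &
        forall i : 'I_m, exists (a : 'cV[R]_d) (b : R),
          forall x : 'cV[R]_d, K x -> P i x -> phi x = dotv a x + b].

Definition cpwl_indicator (R : realType) (d : nat) (K C : set 'cV[R]_d)
    (phi : 'cV[R]_d -> R) : Prop :=
  [/\ compact C,
      cpwl K phi,
      forall x : 'cV[R]_d, K x -> C x -> 0 <= phi x &
      forall x : 'cV[R]_d, K x -> ~ C x -> phi x < 0].

(* Main.v *)
(* Since C_0 is nice, the pieces f_j C_0 are disjoint compact sets, so there is
   a CPwL map T with T = f_j^-1 on f_j C_0.  Then x lies in C_{k+1} iff x lies
   in C_1 and T x lies in C_k, so with CPwL indicators phi_0 of C_0 and phi_1 of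
   C_1 the function
     min (phi_1 (x), phi_1 (T x), ..., phi_1 (T^{k-1} x), phi_0 (T^k x))
   is an indicator of C_k.  It is computed by k iterations of the fixed network
   (x, v) |-> (T x, min (v, phi_1 (x))), so its width does not depend on k. *)
Require Import Defs.
From HB Require Import structures.
From mathcomp Require Import all_boot all_order all_algebra.
From mathcomp Require Import all_classical all_reals all_analysis.

Set Implicit Arguments.
Unset Strict Implicit.
Unset Printing Implicit Defensive.

Import Order.TTheory GRing.Theory Num.Theory.
Import numFieldNormedType.Exports.

Local Open Scope classical_set_scope.
Local Open Scope ring_scope.

(** * Composition of networks and maps computed by a network *)

Section Networks.
Variable R : realType.

(** The given affine map merges into the innermost affine map of [g], so no layer is added and only
    the new input dimension can enlarge the width. *)
Lemma network_comp_affine q n2 n3 (g : network R q n2 n3) :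
  forall n1 (A : 'M[R]_(n2, n1)) (b : 'cV[R]_n2),
  exists h : network R q n1 n3,
    (network_width h <= maxn n1 (network_width g))%N /\
    forall x, network_eval h x = network_eval g (A *m x + b).
Proof.
case: q n2 n3 / g => [m1 m2 C c|q' m1 m m2 C c g] n1 A b.
  exists (Affine (C *m A) (C *m b + c)); split=> [|x] /=.
    by rewrite geq_max leq_maxl !leq_max leqnn !orbT.
  by rewrite mulmxDr mulmxA addrA.
exists (Layer (C *m A) (C *m b + c) g); split=> [|x] /=.
  by rewrite !geq_max leq_maxl !leq_max !leqnn !orbT.
by rewrite mulmxDr mulmxA addrA.
Qed.

(** The outermost affine map of [f] merges with the innermost one of [g]. Hence depths add exactly
    and the width is only a maximum, which is what keeps iterates of a network at bounded width. *)
Lemma network_comp q n1 n2 (f : network R q n1 n2) :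
  forall q' n3 (g : network R q' n2 n3),
  exists h : network R (q + q') n1 n3,
    (network_width h <= maxn (network_width f) (network_width g))%N /\
    forall x, network_eval h x = network_eval g (network_eval f x).
Proof.
elim: f => [m1 m2 A b|q0 m1 m m2 A b f IH] q' n3 g.
  have [h [wh eh]] := network_comp_affine g A b.
  exists h; split=> [|x]; last exact: eh.
  by rewrite (leq_trans wh)// geq_max !leq_max !leqnn !orbT.
have [h [wh eh]] := IH _ _ g.
exists (Layer A b h); split=> [|x] /=; last by rewrite eh.
by rewrite geq_max -maxnA leq_maxl/= (leq_trans wh)// leq_maxr.
Qed.

(** Depth and width are left unspecified: the building blocks are fixed before [k] is chosen, so
    only the final iteration has to count layers. *)
Definition realizable n m (f : 'cV[R]_n -> 'cV[R]_m) : Prop :=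
  exists q (g : network R q n m), forall x, network_eval g x = f x.

Lemma eq_realizable n m (f g : 'cV[R]_n -> 'cV[R]_m) :
  f =1 g -> realizable f -> realizable g.
Proof. by move=> fg [q [h hE]]; exists q, h => x; rewrite hE fg. Qed.

Lemma realizable_affine n m (A : 'M[R]_(m, n)) (b : 'cV[R]_m) :
  realizable (fun x => A *m x + b).
Proof. by exists 0, (Affine A b). Qed.

Lemma realizable_mulmx n m (A : 'M[R]_(m, n)) : realizable (mulmx A).
Proof.
by apply: eq_realizable (realizable_affine A 0) => x; rewrite addr0.
Qed.

Lemma realizable_relu n : realizable (@relu R n).
Proof.
by exists 1, (Layer 1%:M 0 (Affine 1%:M 0)) => x /=; rewrite !mul1mx !addr0.
Qed.

Lemma realizable_comp n1 n2 n3 (f : 'cV[R]_n1 -> 'cV[R]_n2)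
    (g : 'cV[R]_n2 -> 'cV[R]_n3) :
  realizable f -> realizable g -> realizable (g \o f).
Proof.
move=> [q [hf fE]] [q' [hg gE]]; have [h [_ hE]] := network_comp hf hg.
by exists (q + q')%N, h => x; rewrite hE fE gE.
Qed.

(* Through the ReLU layers the untouched block y is carried as the pair
   (max(y,0), max(-y,0)). *)
Lemma realizable_carry p n m (f : 'cV[R]_n -> 'cV[R]_m) : realizable f ->
  realizable (fun z : 'cV_(n + p) => col_mx (f (usubmx z)) (dsubmx z)).
Proof.
move=> [q [g gE]].
apply: (@eq_realizable _ _
  (fun z : 'cV_(n + p) => col_mx (network_eval g (usubmx z)) (dsubmx z))).
  by move=> z; rewrite gE.
elim: g {f gE} => [m1 m2 A b|q0 m1 m' m2 A b g IH] /=.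
  apply: eq_realizable (realizable_affine (block_mx A 0 0 1%:M) (col_mx b 0)).
  move=> z; rewrite -[z in LHS]vsubmxK mul_block_col add_col_mx.
  by rewrite !mul0mx mul1mx !add0r !addr0.
pose B1 : 'M[R]_(m' + (p + p), m1 + p) :=
  col_mx (row_mx A 0) (col_mx (row_mx 0 1%:M) (row_mx 0 (- 1%:M))).
pose B2 : 'M[R]_(m' + p, m' + (p + p)) :=
  block_mx 1%:M 0 0 (row_mx 1%:M (- 1%:M)).
have r1 := realizable_affine B1 (col_mx b (0 : 'cV[R]_(p + p))).
have r2 := realizable_comp r1 (@realizable_relu _).
have r3 := realizable_comp r2 (realizable_mulmx B2).
apply: eq_realizable (realizable_comp r3 IH) => z /=.
have -> : B2 *m relu (B1 *m z + col_mx b 0) =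
    col_mx (relu (A *m usubmx z + b)) (dsubmx z).
  rewrite -[z in LHS]vsubmxK /B1 !mul_col_mx !mul_row_col !mul0mx !addr0.
  rewrite !add0r mul1mx mulNmx mul1mx.
  rewrite add_col_mx addr0 /relu !map_col_mx !mul_row_col.
  rewrite !mul0mx !mul1mx mulNmx mul1mx addr0 add0r; congr col_mx.
  apply/matrixP => i j; rewrite !mxE; set t := z _ _.
  have [t0|t0] := leP t 0.
    by rewrite max_l ?oppr_ge0// sub0r opprK.
  by rewrite max_r ?subr0// oppr_le0 ltW.
by rewrite col_mxKu col_mxKd.
Qed.

(** The two networks may differ in depth, so they run one after the other: x becomes (x, x), then (g
    x, x), is swapped to (x, g x), and ends as (f x, g x). *)
Lemma realizable_pair n m p (f : 'cV[R]_n -> 'cV[R]_m)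
    (g : 'cV[R]_n -> 'cV[R]_p) :
  realizable f -> realizable g -> realizable (fun x => col_mx (f x) (g x)).
Proof.
move=> rf rg.
have r1 := realizable_mulmx (col_mx 1%:M 1%:M : 'M[R]_(n + n, n)).
have r2 := realizable_comp r1 (realizable_carry n rg).
have r3 := realizable_comp r2 (realizable_mulmx (block_mx 0 1%:M 1%:M 0)).
have r4 := realizable_comp r3 (realizable_carry p rf).
apply: eq_realizable r4 => x /=.
rewrite [col_mx _ _ *m x]mul_col_mx mul1mx col_mxKu col_mxKd mul_block_col.
by rewrite !mul0mx !mul1mx add0r addr0 col_mxKu col_mxKd.
Qed.

Lemma realizable_add n m (f g : 'cV[R]_n -> 'cV[R]_m) :
  realizable f -> realizable g -> realizable (fun x => f x + g x).
Proof.
move=> rf rg; have r1 := realizable_pair rf rg.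
apply: eq_realizable (realizable_comp r1 (realizable_mulmx (row_mx 1%:M 1%:M))).
by move=> x /=; rewrite mul_row_col !mul1mx.
Qed.

Lemma realizable_sum n m (I : Type) (s : seq I)
    (f : I -> 'cV[R]_n -> 'cV[R]_m) :
  (forall i, realizable (f i)) -> realizable (fun x => \sum_(i <- s) f i x).
Proof.
move=> rf; elim: s => [|i s IH].
  apply: eq_realizable (realizable_affine 0 0) => x.
  by rewrite big_nil mul0mx addr0.
by apply: eq_realizable (realizable_add (rf i) IH) => x; rewrite big_cons.
Qed.

(** * Scalar functions computed by networks *)

Definition realizable1 n (phi : 'cV[R]_n -> R) : Prop :=
  realizable (fun x => const_mx (phi x) : 'cV[R]_1).

Lemma eq_realizable1 n (f g : 'cV[R]_n -> R) :
  f =1 g -> realizable1 f -> realizable1 g.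
Proof. by move=> fg; apply: eq_realizable => x; rewrite fg. Qed.

Lemma realizable_coord n m (f : 'cV[R]_n -> 'cV[R]_m) (i : 'I_m) :
  realizable f -> realizable1 (fun x => f x i 0).
Proof.
move=> rf.
apply: eq_realizable (realizable_comp rf (realizable_mulmx (delta_mx 0 i))) =>
  x /=.
by rewrite -rowE; apply/matrixP => j k; rewrite !mxE ord1.
Qed.

(** The vector is rebuilt as the sum of its coordinates times basis vectors. This lets
    [realizable_gate] treat each coordinate separately. *)
Lemma realizable_coords n m (f : 'cV[R]_n -> 'cV[R]_m) :
  (forall i, realizable1 (fun x => f x i 0)) -> realizable f.
Proof.
move=> rf.
pose h i x : 'cV[R]_m := delta_mx i 0 *m (const_mx (f x i 0) : 'cV_1).
have rh i : realizable (h i).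
  exact: realizable_comp (rf i) (realizable_mulmx (delta_mx i (0 : 'I_1))).
apply: eq_realizable (realizable_sum (index_enum 'I_m) rh) => x.
apply/matrixP => i j; rewrite summxE (bigD1 i)//= big1 ?addr0.
  by rewrite !mxE big_ord1 !mxE !eqxx mul1r ord1.
by move=> k ki; rewrite !mxE big_ord1 !mxE eq_sym (negPf ki) mul0r.
Qed.

Lemma realizable1_comp n m (f : 'cV[R]_n -> 'cV[R]_m) (phi : 'cV[R]_m -> R) :
  realizable f -> realizable1 phi -> realizable1 (fun x => phi (f x)).
Proof. exact: realizable_comp. Qed.

Lemma realizable1_cst n (c : R) : realizable1 (fun _ : 'cV[R]_n => c).
Proof.
apply: eq_realizable (realizable_affine 0 (const_mx c)) => x.
by rewrite mul0mx add0r.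
Qed.

Lemma realizable1_dotv n (a : 'cV[R]_n) : realizable1 (dotv a).
Proof.
apply: eq_realizable (realizable_mulmx a^T) => x.
apply/matrixP => i j; rewrite !mxE; apply: eq_bigr => k _.
by rewrite !mxE !ord1.
Qed.

Lemma realizable1D n (f g : 'cV[R]_n -> R) :
  realizable1 f -> realizable1 g -> realizable1 (fun x => f x + g x).
Proof.
move=> rf rg; apply: eq_realizable (realizable_add rf rg) => x.
by apply/matrixP => i j; rewrite !mxE.
Qed.

Lemma realizable1Z n (c : R) (f : 'cV[R]_n -> R) :
  realizable1 f -> realizable1 (fun x => c * f x).
Proof.
move=> rf.
apply: eq_realizable (realizable_comp rf (realizable_mulmx c%:M)) => x.
by rewrite /= mul_scalar_mx; apply/matrixP => i j; rewrite !mxE.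
Qed.

Lemma realizable1B n (f g : 'cV[R]_n -> R) :
  realizable1 f -> realizable1 g -> realizable1 (fun x => f x - g x).
Proof.
move=> rf rg; apply: eq_realizable1 (realizable1D rf (realizable1Z (-1) rg)).
by move=> x; rewrite mulN1r.
Qed.

Lemma realizable1_relu n (f : 'cV[R]_n -> R) :
  realizable1 f -> realizable1 (fun x => Num.max (f x) 0).
Proof.
move=> rf; apply: eq_realizable (realizable_comp rf (@realizable_relu 1)) => x.
by apply/matrixP => i j; rewrite !mxE.
Qed.

(** max(a, b) = b + max(a - b, 0); the next lemma uses min(a, b) = a - max(a - b, 0). *)
Lemma realizable1_max n (f g : 'cV[R]_n -> R) :
  realizable1 f -> realizable1 g -> realizable1 (fun x => Num.max (f x) (g x)).
Proof.
move=> rf rg.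
apply: eq_realizable1 (realizable1D rg (realizable1_relu (realizable1B rf rg))).
by move=> x; rewrite addr_maxr subrKC addr0.
Qed.

Lemma realizable1_min n (f g : 'cV[R]_n -> R) :
  realizable1 f -> realizable1 g -> realizable1 (fun x => Num.min (f x) (g x)).
Proof.
move=> rf rg.
apply: eq_realizable1 (realizable1B rf (realizable1_relu (realizable1B rf rg))).
by move=> x; rewrite oppr_max opprB oppr0 addr_minr subrKC addr0 minC.
Qed.

Lemma realizable1_bigmax n (I : Type) (s : seq I) (c : R)
    (f : I -> 'cV[R]_n -> R) :
  (forall i, realizable1 (f i)) ->
  realizable1 (fun x => \big[Num.max/c]_(i <- s) f i x).
Proof.
move=> rf; elim: s => [|i s IH].
  by apply: eq_realizable1 (realizable1_cst _ c) => x; rewrite big_nil.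
by apply: eq_realizable1 (realizable1_max (rf i) IH) => x; rewrite big_cons.
Qed.

Lemma realizable1_bigmin n (I : Type) (s : seq I) (c : R)
    (f : I -> 'cV[R]_n -> R) :
  (forall i, realizable1 (f i)) ->
  realizable1 (fun x => \big[Num.min/c]_(i <- s) f i x).
Proof.
move=> rf; elim: s => [|i s IH].
  by apply: eq_realizable1 (realizable1_cst _ c) => x; rewrite big_nil.
by apply: eq_realizable1 (realizable1_min (rf i) IH) => x; rewrite big_cons.
Qed.

(** * Continuity of networks *)

Lemma continuous_coords (T : topologicalType) n (f : T -> 'cV[R]_n) :
  (forall i, continuous (fun x => f x i 0)) -> continuous f.
Proof.
move=> cf x; apply/cvg_ballP => e e0.
have : \forall y \near x, forall i : 'I_n, ball (f x i 0) e (f y i 0).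
  by apply: filter_forall => i; have /cvg_ballP/(_ e e0) := cf i x.
by apply: filterS => y xy; split=> [|i j]; [|rewrite ord1; exact: xy].
Qed.

Lemma continuous_affine n m (A : 'M[R]_(m, n)) (b : 'cV[R]_m) :
  continuous (fun x : 'cV[R]_n => A *m x + b).
Proof.
apply: continuous_coords => i x.
rewrite (_ : (fun _ => _) =
    (fun y : 'cV[R]_n => \sum_k A i k * y k 0) \+ cst (b i 0)).
  apply: continuousD; last exact: cst_continuous.
  apply: (@continuous_big R^o); first exact: add_continuous.
  move=> k _ y; apply: continuousM; first exact: cst_continuous.
  exact: coord_continuous.
by apply/funext => y; rewrite !mxE.
Qed.

Lemma continuous_network q n m (g : network R q n m) :
    continuous (network_eval g).
Proof.
elim: g => [m1 m2 A b|q0 m1 m' m2 A b g IH] /=; first exact: continuous_affine.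
move=> x; apply: (@continuous_comp _ _ _ (fun y => relu (A *m y + b)));
  last exact: IH.
apply: (@continuous_comp _ _ _ (fun y => A *m y + b)).
  exact: continuous_affine.
apply: continuous_coords => i y.
rewrite (_ : (fun _ => _) = fun z : 'cV[R]_m' => Num.max (z i 0) 0).
  apply: (@continuous_max _ _ (fun z : 'cV[R]_m' => z i 0) (cst 0)).
    exact: coord_continuous.
  exact: cst_continuous.
by apply/funext => z; rewrite !mxE.
Qed.

Lemma realizable_continuous n m (f : 'cV[R]_n -> 'cV[R]_m) :
  realizable f -> continuous f.
Proof.
move=> [q [g gE]]; rewrite -(_ : network_eval g = f); last exact/funext.
exact: continuous_network.
Qed.

Lemma realizable1_continuous n (phi : 'cV[R]_n -> R) :
  realizable1 phi -> continuous phi.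
Proof.
move=> /realizable_continuous cf x.
rewrite (_ : phi = (fun M : 'cV[R]_1 => M 0 0) \o (fun y => const_mx (phi y))).
  by apply: continuous_comp; [exact: cf|exact: coord_continuous].
by apply/funext => y; rewrite /= mxE.
Qed.

(** * Networks are piecewise affine on finitely many polyhedra *)

Lemma dotvE n (a x : 'cV[R]_n) : dotv a x = (a^T *m x) 0 0.
Proof. by rewrite mxE; apply: eq_bigr => i _; rewrite mxE. Qed.

Lemma dotv_delta n (i : 'I_n) (x : 'cV[R]_n) : dotv (delta_mx i 0) x = x i 0.
Proof. by rewrite dotvE trmx_delta -rowE mxE. Qed.

Lemma dotvNl n (a x : 'cV[R]_n) : dotv (- a) x = - dotv a x.
Proof. by rewrite !dotvE linearN mulNmx mxE. Qed.

Lemma dotv_affine n m (a : 'cV[R]_m) (A : 'M[R]_(m, n)) b x :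
  dotv a (A *m x + b) = dotv (A^T *m a) x + dotv a b.
Proof. by rewrite !dotvE mulmxDr mxE trmx_mul trmxK mulmxA. Qed.

(** With lists of constraints, intersection is concatenation. Zero normals are allowed, since
    pulling a constraint back along a singular matrix can produce one. *)
Definition sat n (p : seq ('cV[R]_n * R)) (x : 'cV[R]_n) :=
  all (fun c => dotv c.1 x <= c.2) p.

Definition piecewise_affine n m (f : 'cV[R]_n -> 'cV[R]_m) : Prop :=
  exists s : seq (seq ('cV[R]_n * R)),
    (forall x, exists2 p, p \in s & sat p x) /\
    forall p, p \in s -> exists (A : 'M[R]_(m, n)) (b : 'cV[R]_m),
      forall x, sat p x -> f x = A *m x + b.

Lemma piecewise_affine_affine n m (A : 'M[R]_(m, n)) (b : 'cV[R]_m) :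
  piecewise_affine (fun x => A *m x + b).
Proof.
exists [:: [::]]; split=> [x|p _]; last by exists A, b.
by exists [::]; rewrite ?mem_head.
Qed.

(** The pieces of the composite are the sets of x in a piece [p] of [f] with f x in a piece [q] of
    [g]. On [p] the map [f] is affine, so the condition on f x is again a list of affine
    constraints. *)
Lemma piecewise_affine_comp n1 n2 n3 (f : 'cV[R]_n1 -> 'cV[R]_n2)
    (g : 'cV[R]_n2 -> 'cV[R]_n3) :
  piecewise_affine f -> piecewise_affine g -> piecewise_affine (g \o f).
Proof.
move=> [s [scov sf]] [t [tcov tg]].
have /choice[h hP] : forall p, exists Ab : 'M[R]_(n2, n1) * 'cV[R]_n2,
    p \in s -> forall x, sat p x -> f x = Ab.1 *m x + Ab.2.
  move=> p; have [/sf[A [b fE]]|ps] := boolP (p \in s); first by exists (A, b).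
  by exists (0, 0).
(* The inequality a . (A x + b) <= c is rewritten as (A^T a) . x <= c - a . b. *)
pose pull (p : seq ('cV[R]_n1 * R)) (c : 'cV[R]_n2 * R) :=
  ((h p).1^T *m c.1, c.2 - dotv c.1 (h p).2).
have satE p q x : p \in s ->
    sat (p ++ map (pull p) q) x = sat p x && sat q (f x).
  move=> ps; rewrite /sat all_cat all_map; case: (boolP (all _ p)) => //= px.
  by apply: eq_all => c /=; rewrite (hP p ps x px) dotv_affine lerBrDr.
exists [seq p ++ map (pull p) q | p <- s, q <- t]; split.
  move=> x; have [p ps px] := scov x; have [q qt qx] := tcov (f x).
  by exists (p ++ map (pull p) q); [exact: allpairs_f|rewrite satE// px].
move=> _ /allpairsP[[p q] /= [ps qt ->]].
have [B [c gE]] := tg q qt.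
exists (B *m (h p).1), (B *m (h p).2 + c) => x.
rewrite satE// => /andP[px qx].
by rewrite /= (gE _ qx) (hP p ps x px) mulmxDr mulmxA addrA.
Qed.

(** The pieces are the closed orthants, indexed by the set [D] of coordinates required to be
    nonnegative; on each, ReLU is the diagonal projection onto the coordinates in [D]. *)
Lemma piecewise_affine_relu n : piecewise_affine (@relu R n).
Proof.
pose pat (D : {set 'I_n}) : seq ('cV[R]_n * R) :=
  [seq (if i \in D then - delta_mx i 0 else delta_mx i 0, 0) | i <- enum 'I_n].
have satE D x : sat (pat D) x =
    [forall i, if i \in D then 0 <= x i 0 else x i 0 <= 0].
  rewrite /sat all_map; apply/allP/forallP => /= [H i|H i _].
    have := H i (mem_enum _ _); case: ifP => _; last by rewrite dotv_delta.
    by rewrite dotvNl dotv_delta oppr_le0.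
  have := H i; case: ifP => _; last by rewrite dotv_delta.
  by rewrite dotvNl dotv_delta oppr_le0.
exists [seq pat D | D <- enum {set 'I_n}]; split.
  move=> x; exists (pat [set i | 0 <= x i 0]%SET); first exact/map_f/mem_enum.
  rewrite satE; apply/forallP => i; rewrite inE.
  by case: ifP => // /negbT; rewrite -ltNge => /ltW.
move=> _ /mapP[D _ ->].
exists (diag_mx (\row_i (i \in D)%:R)), 0 => x; rewrite satE => /forallP xS.
apply/matrixP => i j; rewrite addr0 mul_diag_mx !mxE ord1.
have := xS i; case: ifP => _ xi; first by rewrite mul1r max_l.
by rewrite mul0r max_r.
Qed.

Lemma realizable_piecewise_affine n m (f : 'cV[R]_n -> 'cV[R]_m) :
  realizable f -> piecewise_affine f.
Proof.
move=> [q [g gE]]; rewrite -(_ : network_eval g = f); last exact/funext.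
elim: g {f gE} => [m1 m2 A b|q0 m1 m' m2 A b g IH] /=.
  exact: piecewise_affine_affine.
exact: piecewise_affine_comp (piecewise_affine_comp
  (piecewise_affine_affine A b) (@piecewise_affine_relu m')) IH.
Qed.

Lemma polyhedron_sat n (p : seq ('cV[R]_n * R)) :
  {in p, forall c, c.1 != 0} -> polyhedron (sat p).
Proof.
move=> p0; pose c (i : 'I_(size p)) := tnth (in_tuple p) i.
exists (size p), (fun i => [set x | dotv (c i).1 x <= (c i).2]); split.
  by move=> i; exists (c i).1, (c i).2; split=> //; exact/p0/mem_tnth.
apply/seteqP; split=> [x /allP px i _|x px] /=; first exact/px/mem_tnth.
apply/allP => a ap; have [i ->] := tnthP (in_tuple p) a ap.
exact: px.
Qed.

(* [closed_halfspace] excludes zero normal vectors: on a nonempty piece the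
   constraints with zero normal hold identically and can be dropped, and the
   empty pieces are discarded. *)
Lemma realizable1_cpwl n (K : set 'cV[R]_n) (phi : 'cV[R]_n -> R) :
  realizable1 phi -> cpwl K phi.
Proof.
move=> rphi; split.
  exact/continuous_subspaceT/realizable1_continuous.
have [s [scov sphi]] := realizable_piecewise_affine rphi.
pose clean (p : seq ('cV[R]_n * R)) := [seq c <- p | c.1 != 0].
have dot0 (x : 'cV[R]_n) : dotv 0 x = 0 by rewrite dotvE trmx0 mul0mx mxE.
have cleanE p x0 : sat p x0 -> sat (clean p) = sat p.
  move=> /allP px0; apply/funext => x; rewrite /sat all_filter.
  apply: eq_in_all => c /px0 /=; case: eqVneq => //= ->.
  by rewrite !dot0.
pose s' := [seq p <- s | `[< exists x, sat p x >]].
exists (size s'), (fun i => sat (clean (tnth (in_tuple s') i))); split.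
- by move=> i; apply: polyhedron_sat => c; rewrite mem_filter => /andP[].
- move=> x _; have [p ps px] := scov x.
  have /tnthP[i pE] : p \in in_tuple s'.
    by rewrite mem_filter ps andbT; apply/asboolP; exists x.
  by exists i => //=; rewrite -pE (cleanE p x).
- move=> i; have : tnth (in_tuple s') i \in s' by exact: mem_tnth.
  rewrite mem_filter => /andP[/asboolP[x0 px0] /sphi[A [b fE]]].
  exists A^T, (b 0 0) => x _; rewrite (cleanE _ x0 px0) => /fE /matrixP/(_ 0 0).
  by rewrite !mxE => ->; congr (_ + _); apply: eq_bigr => k _; rewrite !mxE.
Qed.

(** * Indicators built from min and max, and gating by an indicator *)

Lemma polyhedron_indicator n (P : set 'cV[R]_n) : polyhedron P ->
  exists phi, realizable1 phi /\ forall x, P x <-> 0 <= phi x.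
Proof.
move=> [m [H [hH ->]]].
have /choice[c cP] : forall i, exists c : 'cV[R]_n * R,
    H i = [set x | dotv c.1 x <= c.2].
  by move=> i; have [a [b [_ HE]]] := hH i; exists (a, b).
(* The minimum of the slacks is nonnegative exactly when every constraint holds. The default 1 does
   not affect the sign test and gives the whole space when there is no constraint. *)
exists (fun x => \big[Num.min/1]_i ((c i).2 - dotv (c i).1 x)); split.
  apply: realizable1_bigmin => i.
  exact: realizable1B (realizable1_cst _ _) (realizable1_dotv _).
move=> x; split=> [Hx|/bigmin_geP[_ Hx] i _].
  apply/bigmin_geP; split=> // i _; rewrite subr_ge0.
  by have := Hx i I; rewrite cP.
by have := Hx i isT; rewrite subr_ge0 cP.
Qed.

(** The default -1 is negative, so it never makes the maximum nonnegative; an empty family thus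
    indicates the empty set. *)
Lemma bigmax_ge0P n m (phi : 'I_m -> 'cV[R]_n -> R) x :
  0 <= \big[Num.max/-1]_i phi i x <-> exists i, 0 <= phi i x.
Proof.
split=> [|[i xi]]; last by rewrite (le_trans xi)// le_bigmax.
rewrite leNgt => /negP H; apply: contrapT => /forallNP nx; apply: H.
by apply/bigmax_ltP; split=> [|i _]; [rewrite ltrN10|rewrite ltNge; exact/negP].
Qed.

Lemma polytopes_indicator n (C : set 'cV[R]_n) : finite_union_of_polytopes C ->
  exists phi, realizable1 phi /\ forall x, C x <-> 0 <= phi x.
Proof.
move=> [m [P [hP ->]]].
have /choice[phi phiP] : forall i, exists phi : 'cV[R]_n -> R,
    realizable1 phi /\ forall x, P i x <-> 0 <= phi x.
  by move=> i; have [/polyhedron_indicator] := hP i.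
exists (fun x => \big[Num.max/-1]_i phi i x); split.
  by apply: realizable1_bigmax => i; have [] := phiP i.
move=> x; rewrite bigmax_ge0P; split=> [[i _ xi]|[i xi]]; exists i => //.
  exact/(phiP i).2.
exact/(phiP i).2.
Qed.

(* Subtracting a large multiple of max(-psi,0) from both the positive and the
   negative part of g leaves g unchanged where psi >= 0 and kills it on E. *)
Lemma realizable1_gate n (E : set 'cV[R]_n) (psi g : 'cV[R]_n -> R) :
  compact E -> realizable1 psi -> realizable1 g ->
  (forall x, E x -> psi x < 0) ->
  exists G, [/\ realizable1 G, forall x, 0 <= psi x -> G x = g x &
    forall x, E x -> G x = 0].
Proof.
move=> cE rpsi rg psiE.
(* The extreme value theorem below needs a point of [E]; if there is none, [g] itself serves. *)
have [->|E0] := eqVneq E set0; first by exists g; split.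
have cpsi : {within E, continuous psi}.
  exact/continuous_subspaceT/realizable1_continuous.
have /set0P nE := E0; have [c] := compact_EVT_max nE cE cpsi.
rewrite inE => Ec psic.
have /ex_strict_bound_gt0[M M0 gM] : bounded_set (g @` E).
  apply/compact_bounded/continuous_compact => //.
  exact/continuous_subspaceT/realizable1_continuous.
have psic0 := psiE _ Ec.
(* On [E], [psi] is at most its maximum [psi c] < 0 and |g| is at most [M]. With this slope the
   penalty [p] is at least [M] on [E], and it vanishes where [psi] >= 0. *)
pose N := M / - psi c.
pose p x := N * Num.max (-1 * psi x) 0.
have rp : realizable1 p by exact/realizable1Z/realizable1_relu/realizable1Z.
exists (fun x => Num.max (g x - p x) 0 - Num.max (-1 * g x - p x) 0); split.
- apply: realizable1B; apply: realizable1_relu; apply: realizable1B => //.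
  exact: realizable1Z.
- move=> x psix; have -> : p x = 0 by rewrite /p mulN1r max_r ?oppr_le0// mulr0.
  rewrite !subr0 mulN1r.
  have [gx|gx] := leP (g x) 0.
    by rewrite max_l ?oppr_ge0// sub0r opprK.
  by rewrite max_r ?subr0// oppr_le0 ltW.
- move=> x Ex.
  have gp : `|g x| <= p x.
    apply: (@le_trans _ _ M); first by apply/ltW/gM; exists x.
    rewrite /p mulN1r max_l; last by rewrite oppr_ge0 ltW// psiE.
    rewrite /N -mulrA ler_peMr ?(ltW M0)// ler_pdivlMl ?oppr_gt0//.
    by rewrite mulr1 lerN2 psic// inE.
  move: gp; rewrite ler_norml => /andP[g1 g2].
  by rewrite !max_r ?subr0// subr_le0// mulN1r lerNl.
Qed.

Lemma realizable_gate n m (E : set 'cV[R]_n) (psi : 'cV[R]_n -> R)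
    (g : 'cV[R]_n -> 'cV[R]_m) :
  compact E -> realizable1 psi -> realizable g ->
  (forall x, E x -> psi x < 0) ->
  exists G, [/\ realizable G, forall x, 0 <= psi x -> G x = g x &
    forall x, E x -> G x = 0].
Proof.
move=> cE rpsi rg psiE.
have /choice[G GP] :=
  fun i => realizable1_gate cE rpsi (realizable_coord i rg) psiE.
exists (fun x => \col_i G i x); split.
- apply: realizable_coords => i; have [rG _ _] := GP i.
  by apply: eq_realizable1 rG => x; rewrite mxE.
- move=> x psix; apply/matrixP => i j; have [_ /(_ x psix) GE _] := GP i.
  by rewrite mxE GE ord1.
- move=> x Ex; apply/matrixP => i j; have [_ _ /(_ x Ex) GE] := GP i.
  by rewrite !mxE.
Qed.

(** * The Hutchinson iterates and the expanding map [T] *)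

Lemma compact_bigcup_finite (T : topologicalType) (I : finType) (A : set I)
    (F : I -> set T) :
  (forall i, compact (F i)) -> compact (\bigcup_(i in A) F i).
Proof.
move=> cF; rewrite (_ : \bigcup_(i in A) _ = \big[setU/set0]_(i | i \in A) F i).
  by apply: bigsetU_compact => i _.
rewrite -bigcup_seq_cond; apply: eq_bigcupl; split=> i /=.
  by move=> /mem_set Ai; rewrite mem_index_enum.
by move=> /andP[_ /set_mem].
Qed.

Section Hutchinson.
Variables (d J : nat) (f : 'I_J -> 'cV[R]_d -> 'cV[R]_d) (C0 : set 'cV[R]_d).
Hypothesis f_affine : forall j, invertible_affine (f j).
Hypothesis C0_compact : compact C0.
Hypothesis C0_nice : nice f C0.

Lemma invertible_affine_continuous j : continuous (f j).
Proof.
have [A [b [_ fE]]] := f_affine j.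
rewrite (_ : f j = fun x => A *m x + b); last exact/funext.
exact: continuous_affine.
Qed.

Lemma compact_affine_image j (C : set 'cV[R]_d) :
  compact C -> compact (f j @` C).
Proof.
by apply/continuous_compact/continuous_subspaceT/invertible_affine_continuous.
Qed.

Lemma hutchinson_compact (C : set 'cV[R]_d) :
  compact C -> compact (hutchinson f C).
Proof.
by move=> cC; apply: compact_bigcup_finite => j; exact: compact_affine_image.
Qed.

Lemma iter_hutchinson_compact k : compact (iter k (hutchinson f) C0).
Proof. by elim: k => //= k; exact: hutchinson_compact. Qed.

(** Needed because [T] is known to undo [f j] only on points of [C0]. *)
Lemma hutchinson_sub k : iter k (hutchinson f) C0 `<=` C0.
Proof.
have [_ fC0 _] := C0_nice.
elim: k => //= k IH x [j _ [y Cy <-]]; apply: fC0; exists y => //; exact: IH.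
Qed.

Lemma realizable_inverse :
  exists g : 'I_J -> 'cV[R]_d -> 'cV[R]_d, [/\ forall j, realizable (g j),
    forall j, cancel (f j) (g j) & forall j, cancel (g j) (f j)].
Proof.
have /choice[g gP] : forall j, exists g,
    [/\ realizable g, cancel (f j) g & cancel g (f j)].
  move=> j; have [A [b [uA fE]]] := f_affine j.
  exists (fun x => invmx A *m x + - (invmx A *m b)); split.
  - exact: realizable_affine.
  - by move=> x; rewrite fE mulmxDr mulKmx// addrK.
  - by move=> x; rewrite fE mulmxBr !mulKVmx// subrK.
by exists g; split=> j; have [] := gP j.
Qed.

Variables (phi0 : 'cV[R]_d -> R).
Hypothesis phi0_realizable : realizable1 phi0.
Hypothesis phi0P : forall x, C0 x <-> 0 <= phi0 x.

Lemma image_indicator j g : cancel (f j) g -> cancel g (f j) ->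
  forall x, (f j @` C0) x <-> 0 <= phi0 (g x).
Proof.
move=> fK gK x; rewrite -phi0P; split=> [[y Cy <-]|Cgx]; first by rewrite fK.
by exists (g x).
Qed.

(** Since [g j] inverts [f j], the function [phi0 \o g j] indicates the piece f_j C_0; the maximum
    over [j] indicates the union. *)
Lemma hutchinson_indicator :
  exists phi, realizable1 phi /\ forall x, hutchinson f C0 x <-> 0 <= phi x.
Proof.
have [g [rg fK gK]] := realizable_inverse.
exists (fun x => \big[Num.max/-1]_j phi0 (g j x)); split.
  by apply: realizable1_bigmax => j; exact: realizable1_comp.
move=> x; rewrite (bigmax_ge0P (fun j => phi0 \o g j)).
split=> [[j _ fx]|[j fx]]; exists j => //.
  exact/(image_indicator (fK j) (gK j)).
exact/(image_indicator (fK j) (gK j)).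
Qed.

(** Each inverse [g j] is gated by [phi0 \o g j], which is nonnegative on the piece f_j C_0 and, by
    disjointness, negative on the compact union [E j] of the other pieces. In the sum of the gated
    inverses only the term [j] survives on f_j C_0. *)
Lemma realizable_expansion :
  exists T, realizable T /\ forall j y, C0 y -> T (f j y) = y.
Proof.
have [_ _ disj] := C0_nice.
have [g [rg fK gK]] := realizable_inverse.
pose E j := \bigcup_(i in [set i | i != j]) (f i @` C0).
have /choice[G GP] : forall j, exists G, [/\ realizable G,
    forall x, 0 <= phi0 (g j x) -> G x = g j x & forall x, E j x -> G x = 0].
  move=> j; apply: realizable_gate => //.
  - by apply: compact_bigcup_finite => i; exact: compact_affine_image.
  - exact: realizable1_comp.
  - move=> x [i /= ij fx]; rewrite ltNge; apply/negP.
    move=> /(image_indicator (fK j) (gK j)) fjx.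
    by have := disj _ _ ij; rewrite -subset0 => /(_ x); apply.
exists (fun x => \sum_j G j x); split.
  by apply: realizable_sum => j; have [] := GP j.
move=> j y Cy; rewrite (bigD1 j)//= big1 ?addr0.
  by have [_ GE _] := GP j; rewrite GE fK//; apply/phi0P.
by move=> i ij; have [_ _ ->] := GP i => //; exists j;
  [rewrite /= eq_sym|exists y].
Qed.

(** If x = f_j y with y in [C0], then T x = y, so membership of x one level up is membership of T x.
    Off the pieces nothing is known about [T], hence the separate condition that x lie in
    [hutchinson f C0]. *)
Lemma iter_hutchinsonS T : (forall j y, C0 y -> T (f j y) = y) ->
  forall k x, iter k.+1 (hutchinson f) C0 x <->
    hutchinson f C0 x /\ iter k (hutchinson f) C0 (T x).
Proof.
move=> TE k x; split=> [[j _ [y Cy <-]]|[[j _ [y Cy <-]]]].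
  have C0y := hutchinson_sub Cy.
  by split; [exists j => //; exists y|rewrite TE].
by rewrite TE// => Ty; exists j => //; exists y.
Qed.

End Hutchinson.

(** * Iterating a fixed network and assembling the indicator of C_k *)

Lemma network_iter q n (s : network R q n n) q' m (g : network R q' n m) k :
  exists h : network R (k * q + q') n m,
    (network_width h <= maxn (network_width s) (network_width g))%N /\
    forall x, network_eval h x = network_eval g (iter k (network_eval s) x).
Proof.
elim: k => [|k [h [wh hE]]]; first by exists g; split=> //; exact: leq_maxr.
rewrite mulSn -addnA; have [h' [wh' h'E]] := network_comp s h.
exists h'; split=> [|x]; last by rewrite h'E hE iterSr.
by rewrite (leq_trans wh')// geq_max leq_maxl.
Qed.

End Networks.

Theorem theorem1 (R : realType) (d J : nat)
    (f : 'I_J -> 'cV[R]_d -> 'cV[R]_d) (C0 : set 'cV[R]_d)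
    (K : set 'cV[R]_d) :
  is_IFS f ->
  compact C0 ->
  nice f C0 ->
  finite_union_of_polytopes C0 ->
  (forall j : 'I_J, invertible_affine (f j)) ->
  compact K ->
  exists W0 L0 : nat, forall k : nat, (1 <= k)%N ->
    exists phi : 'cV[R]_d -> R,
      cpwl_indicator K (iter k (hutchinson f) C0) phi /\
      NNF K W0 (L0 * k) (fun x : 'cV[R]_d => const_mx (phi x) : 'cV[R]_1).
Proof.
move=> _ C0_compact C0_nice C0_poly f_affine _.
have [phi0 [rphi0 phi0P]] := polytopes_indicator C0_poly.
have [phi1 [rphi1 phi1P]] := hutchinson_indicator f_affine rphi0 phi0P.
have [T [rT TE]] :=
  realizable_expansion f_affine C0_compact C0_nice rphi0 phi0P.
have TP := iter_hutchinsonS C0_nice TE.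
(* The state of the iteration is a point of R^d followed by one coordinate for the running
   minimum. *)
pose pt (z : 'cV[R]_(d + 1)) := usubmx z.
pose acc (z : 'cV[R]_(d + 1)) := dsubmx z 0 0.
have rpt : realizable pt.
  apply: eq_realizable (realizable_mulmx (row_mx 1%:M 0)) => z.
  by rewrite -[in LHS](vsubmxK z) mul_row_col mul1mx mul0mx addr0.
have racc : realizable1 acc.
  apply: eq_realizable1 (realizable_coord (rshift d 0) (realizable_mulmx 1%:M)).
  by move=> z; rewrite mul1mx /acc mxE.
have [qs [s sE]] := realizable_pair (realizable_comp rpt rT)
  (realizable1_min racc (realizable1_comp rpt rphi1)).
have [qo [out outE]] := realizable1_min racc (realizable1_comp rpt rphi0).
(* The initial value of the running minimum stays arbitrary, because each step of the induction
   changes it. *)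
have iterP k : forall z,
    0 <= network_eval out (iter k (network_eval s) z) 0 0 <->
    0 <= acc z /\ iter k (hutchinson f) C0 (pt z).
  elim: k => [|k IH] z.
    rewrite /= outE mxE le_min phi0P.
    by split=> [/andP|[-> ->]].
  rewrite iterSr IH TP sE /acc /pt col_mxKu col_mxKd mxE le_min phi1P.
  split=> [[/andP[a0 z0] Tz]|[a0 [z0 Tz]]]; first by [].
  by split=> //; apply/andP.
(* The [d] accounts for the input of the affine embedding placed before the iterated network. *)
exists (maxn d (maxn (network_width s) (network_width out))),
  (qs + qo)%N => k k1.
have [h [wh hE]] := network_iter s out k.
(* The input x enters as (x, 1): starting the running minimum at the nonnegative value 1 imposes no
   condition. *)
have [g [wg gE]] :=
  network_comp_affine h (col_mx 1%:M 0) (col_mx 0 (const_mx 1)).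
exists (fun x => network_eval g x 0 0); split; last first.
  exists (k * qs + qo)%N, g; split.
  (* Here [k] >= 1 is used: the readout depth [qo] occurs once and is absorbed by [qo * k]. *)
  - by rewrite mulnDl leq_add ?(mulnC k)// leq_pmulr.
  - by rewrite (leq_trans wg)// geq_max leq_maxl leq_max wh orbT.
  - by move=> x _; apply/matrixP => i j; rewrite mxE !ord1.
have gP x : 0 <= network_eval g x 0 0 <-> iter k (hutchinson f) C0 x.
  rewrite gE hE iterP mul_col_mx mul1mx mul0mx add_col_mx addr0 add0r.
  by rewrite /acc /pt col_mxKu col_mxKd mxE; split=> [[]|].
split.
- exact: iter_hutchinson_compact.
- apply/realizable1_cpwl/realizable_coord.
  by exists (k * qs + qo)%N, g.
- by move=> x _ /gP.
- by move=> x _ nCx; rewrite ltNge; apply/negP => /gP.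
Qed.
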